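(* Let $u:\mathbb{R}^2\to\mathbb{C}\cong\mathbb{R}^2$ be of class $C^2$ and satisfy $$-\Delta u = u(1-|u|^2)\quad\text{in }\mathbb{R}^2,\qquad \int_{\mathbb{R}^2}(1-|u|^2)^2\,dx<\infty .$$ Assume in addition that there is an angle $\beta\in[0,2\pi)$ such that $$\nabla\times(\mathcal{R}_\beta u)=0\quad\text{in }\mathbb{R}^2,$$ and that there is one and only one point $x_0\in\mathbb{R}^2$ with $u(x_0)=0$. Then, for one choice of the sign $\pm$, $$(\mathcal{R}_\beta u)(x+x_0)=\pm\frac{x}{|x|}\,f_1(|x|)\qquad\text{for all }x\in\mathbb{R}^2$$ (the right side being understood as $0$ at $x=0$), where $f_1$ is the unique non-negative solution of $$-f_1''(r)-\frac1r f_1'(r)+\frac{1}{r^2}f_1(r)=f_1(r)\bigl(1-f_1(r)^2\bigr),\quad r\in(0,\infty),\qquad f_1(0)=0,\quad \lim_{r\to\infty}f_1(r)=1 .$$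
   Context: The target space $\mathbb{C}$ is identified with $\mathbb{R}^2$, so $u=(u_1,u_2)$ is regarded as a vector field on $\mathbb{R}^2$. $\mathcal{R}_\beta\in SO(2)$ denotes the rotation by the angle $\beta$, acting on the target: $(\mathcal{R}_\beta u)(x)=\mathcal{R}_\beta(u(x))$. For a planar vector field $w=(w_1,w_2)$, $\nabla\times w=\partial_1w_2-\partial_2w_1$. Existence and uniqueness of the non-negative solution $f_1$ of the stated ODE problem is a known result. *)

(* Defs.v *)
From HB Require Import structures.
From mathcomp Require Import all_boot all_order all_algebra.
From mathcomp Require Import all_classical all_reals all_analysis.

Set Implicit Arguments.
Unset Strict Implicit.
Unset Printing Implicit Defensive.

Import Order.TTheory GRing.Theory Num.Theory.
Import numFieldNormedType.Exports.

Local Open Scope classical_set_scope.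
Local Open Scope ring_scope.

(* The plane, both as domain and as target, is [R * R].  The library norm on
   [R * R] is the sup norm, so the Euclidean norm is defined separately. *)
Definition enorm (R : realType) (x : R * R) : R :=
  Num.sqrt (x.1 ^+ 2 + x.2 ^+ 2).

Definition e1 (R : realType) : R * R := (1, 0).
Definition e2 (R : realType) : R * R := (0, 1).

Definition C1 (R : realType) (V : normedModType R) (f : R * R -> V) : Prop :=
  [/\ forall x, derivable f x (e1 R), forall x, derivable f x (e2 R),
      continuous ('D_(e1 R) f) & continuous ('D_(e2 R) f)].

Definition C2 (R : realType) (V : normedModType R) (f : R * R -> V) : Prop :=
  [/\ C1 f, C1 ('D_(e1 R) f) & C1 ('D_(e2 R) f)].

Definition laplacian (R : realType) (V : normedModType R) (f : R * R -> V)
    (x : R * R) : V :=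
  'D_(e1 R) ('D_(e1 R) f) x + 'D_(e2 R) ('D_(e2 R) f) x.

Definition curl (R : realType) (w : R * R -> R * R) (x : R * R) : R :=
  'D_(e1 R) (fun y => (w y).2) x - 'D_(e2 R) (fun y => (w y).1) x.

Definition rotate (R : realType) (beta : R) (z : R * R) : R * R :=
  (cos beta * z.1 - sin beta * z.2, sin beta * z.1 + cos beta * z.2).

(* Only the values of [f] on [0, +oo[ matter.  The boundary condition f(0) = 0
   is meant for f continuous on [0, +oo[, hence the limit at 0+. *)
Definition nonneg_vortex_profile (R : realType) (f : R -> R) : Prop :=
  (forall r : R, 0 <= r -> 0 <= f r) /\
  (forall r : R, 0 < r ->
     [/\ derivable f r 1, derivable (derive1 f) r 1 &
         - derive1 (derive1 f) r - r^-1 * derive1 f r + (r ^+ 2)^-1 * f r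
           = f r * (1 - f r ^+ 2)]) /\
  f 0 = 0 /\
  f r @[r --> 0^'+] --> (0 : R) /\
  f r @[r --> +oo] --> (1 : R).

(* Main.v *)
(* Write w for R_beta u, translated so that its zero is the origin.  As w is
   curl-free, its Jacobian H is symmetric, and the equation says that
   grad (div w) = (|w|^2 - 1) w.  Symmetry of the Hessian of div w then forces
   H w to be parallel to w, so the direction of w is constant along the straight
   lines tangent to w, as long as they avoid the zero.  If one of these lines,
   through p with direction v = w(p), missed the origin, then on the half-plane
   bounded by the parallel to it through the origin and containing it, every
   other such line would have to be parallel to v, because it would otherwise
   cross the first one.  Then w would be constant along the normal to v issued
   from the origin, hence zero there.  So w(x) is parallel to x everywhere, and
   H w parallel to w makes w(x).x constant on circles: w(x) = F(|x|) x / |x| where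
   F has a constant sign and solves the profile equation.

   Uniqueness of the profile: for solutions f > 0 and g >= 0 the weighted
   Wronskian V = r (f g' - g f') satisfies V' = r f g (g^2 - f^2), and
   (g / f)' = V / (r f^2).  If g / f were different from 1 somewhere, then either
   V would stay away from 0 near r = 0, so that g would oscillate by a fixed
   amount between r and 2r, or g / f (or f / g) would grow at least like log r.
   Finite potential energy rules this out: f takes values in [1/2, 2]
   arbitrarily far away. *)

Require Import Defs.
From HB Require Import structures.
From mathcomp Require Import all_boot all_order all_algebra.
From mathcomp Require Import all_classical all_reals all_analysis.
From mathcomp Require Import ring lra.

Import Order.TTheory GRing.Theory Num.Theory.
Import numFieldNormedType.Exports.

Local Open Scope classical_set_scope.
Local Open Scope ring_scope.

(** * One-variable calculus from the mean value theorem *)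

Lemma derive_continuous {R : realType} {f : R -> R} {x d : R} :
  is_derive x 1 f d -> {for x, continuous f}.
Proof.
by move=> fd; apply: differentiable_continuous; apply/derivable1_diffP.
Qed.

Lemma within_continuous {R : realType} (f df : R -> R) (a b : R) :
  (forall x : R, a <= x <= b -> is_derive x 1 f (df x)) ->
  {within `[a, b], continuous f}.
Proof.
move=> fd; apply: continuous_in_subspaceT => x; rewrite inE/= in_itv/= => xab.
exact: derive_continuous (fd _ xab).
Qed.

Lemma mean_value {R : realType} {f df : R -> R} {a b : R} : a < b ->
  (forall x : R, a <= x <= b -> is_derive x 1 f (df x)) ->
  exists c, [/\ a < c, c < b & f b - f a = df c * (b - a)].
Proof.
move=> ab fd.
have [|c cab fE] := MVT (df := df) ab _ (within_continuous _ _ _ _ fd).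
  by move=> x; rewrite in_itv/= => /andP[ax xb]; apply: fd; rewrite !ltW.
by move: cab; rewrite in_itv/= => /andP[ac cb]; exists c.
Qed.

(** The bound on [c] covers either order of [a] and [b], and forces [c] to tend to [a] as [b]
    does. *)
Lemma mean_value_sym {R : realType} (f df : R -> R) (a b : R) :
  (forall x : R, is_derive x 1 f (df x)) ->
  exists c, `|c - a| <= `|b - a| /\ f b - f a = df c * (b - a).
Proof.
move=> fd; case: (ltgtP a b) => [ab|ba|<-].
- have [c [ac cb fE]] := mean_value ab (fun x _ => fd x).
  by exists c; split=> //; rewrite !gtr0_norm ?subr_gt0 ?lerD2r// ltW.
- have [c [bc ca fE]] := mean_value ba (fun x _ => fd x).
  exists c; split; last by rewrite -opprB fE; ring.
  by rewrite !ltr0_norm ?subr_lt0// lerN2 lerD2r ltW.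
- by exists a; split=> //; rewrite !subrr mulr0.
Qed.

Lemma derive_ge0_le {R : realType} {f df : R -> R} {a b : R} : a <= b ->
  (forall x : R, a <= x <= b -> is_derive x 1 f (df x)) ->
  (forall x, a < x < b -> 0 <= df x) -> f a <= f b.
Proof.
rewrite le_eqVlt => /predU1P[<- //|ab] fd df0.
have [c [ac cb fE]] := mean_value ab fd.
by rewrite -subr_ge0 fE mulr_ge0 ?subr_ge0 ?(ltW ab)// df0// ac.
Qed.

Lemma derive_gt0_lt {R : realType} {f df : R -> R} {a b : R} : a < b ->
  (forall x : R, a <= x <= b -> is_derive x 1 f (df x)) ->
  (forall x, a < x < b -> 0 < df x) -> f a < f b.
Proof.
move=> ab fd df0.
have [c [ac cb fE]] := mean_value ab fd.
by rewrite -subr_gt0 fE mulr_gt0 ?subr_gt0// df0// ac.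
Qed.

(** * Functions of two variables *)

(** The partial derivatives are named arguments, so that a curl-free field is given by two such
    statements sharing one function [h12]. *)
Definition is_C1 {R : realType} (f f1 f2 : R * R -> R) : Prop :=
  [/\ continuous f1, continuous f2,
      forall x y : R, is_derive x 1 (fun s => f (s, y)) (f1 (x, y)) &
      forall x y : R, is_derive y 1 (fun s => f (x, s)) (f2 (x, y))].

(** The increment is split along two sides of a rectangle, first horizontally at height [q.2], then
    vertically through [p]. [A] and [B] are the partial derivatives at mean value points, and these
    points tend to [p] with [q]. *)
Lemma is_C1_Hadamard {R : realType} {f f1 f2 : R * R -> R} (p : R * R) :
  is_C1 f f1 f2 -> exists A B : R * R -> R,
  [/\ {for p, continuous A}, {for p, continuous B}, A p = f1 p, B p = f2 p &
      forall q, f q - f p = A q * (q.1 - p.1) + B q * (q.2 - p.2)].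
Proof.
case: p => x y [cf1 cf2 df1 df2].
have /choice[xi xiP] : forall q : R * R, exists c, `|c - x| <= `|q.1 - x| /\
    f (q.1, q.2) - f (x, q.2) = f1 (c, q.2) * (q.1 - x).
  by move=> q; apply: (mean_value_sym (fun r => f (r, q.2))
    (fun r => f1 (r, q.2))) => r.
have /choice[et etP] : forall q : R * R, exists c, `|c - y| <= `|q.2 - y| /\
    f (x, q.2) - f (x, y) = f2 (x, c) * (q.2 - y).
  by move=> q; apply: (mean_value_sym (fun r => f (x, r))
    (fun r => f2 (x, r))) => r.
have near_cvg (g h : R * R -> R) : {for (x, y), continuous h} ->
    (forall s, `|g s - h (x, y)| <= `|h s - h (x, y)|) ->
    g s @[s --> (x, y)] --> h (x, y).
  move=> ch gh; apply/cvgrPdist_le => e e0.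
  have /cvgrPdist_le/(_ e e0) := ch.
  by apply: filterS => s; rewrite distrC => /(le_trans (gh s)); rewrite distrC.
have cfst : {for (x, y), continuous (fst : R * R -> R)} by exact: cvg_fst.
have csnd : {for (x, y), continuous (snd : R * R -> R)} by exact: cvg_snd.
have cxi := near_cvg xi _ cfst (fun s => (xiP s).1).
have cet := near_cvg et _ csnd (fun s => (etP s).1).
have eq0 (c d : R) : `|c - d| <= `|d - d| -> c = d.
  by rewrite subrr normr0 normr_le0 subr_eq0 => /eqP.
have xit : xi (x, y) = x by apply: eq0; case: (xiP (x, y)).
have ett : et (x, y) = y by apply: eq0; case: (etP (x, y)).
exists (fun q => f1 (xi q, q.2)), (fun q => f2 (x, et q)); split=> /=.
- rewrite /prop_for /continuous_at /= xit.
  apply: (@cvg_comp _ _ _ (fun q => (xi q, q.2)) f1 _ (nbhs (x, y)));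
    last exact: cf1.
  exact: (cvg_pair (G := nbhs x) (H := nbhs y) cxi csnd).
- rewrite /prop_for /continuous_at /= ett.
  apply: (@cvg_comp _ _ _ (fun q => (x, et q)) f2 _ (nbhs (x, y)));
    last exact: cf2.
  exact: (cvg_pair (G := nbhs x) (H := nbhs y) (cvg_cst _) cet).
- by rewrite xit.
- by rewrite ett.
- move=> [a b]; have [_ /= <-] := xiP (a, b); have [_ /= <-] := etP (a, b).
  by rewrite subrKA.
Qed.

Lemma is_C1_continuous {R : realType} {f f1 f2 : R * R -> R} :
  is_C1 f f1 f2 -> continuous f.
Proof.
move=> C1f p; have [A [B [cA cB _ _ fE]]] := is_C1_Hadamard p C1f.
have -> : f = fun q => f p + (A q * (q.1 - p.1) + B q * (q.2 - p.2)).
  by apply/funext => q; rewrite -fE addrC subrK.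
have cfst : (fst : R * R -> R) q @[q --> p] --> p.1 by exact: cvg_fst.
have csnd : (snd : R * R -> R) q @[q --> p] --> p.2 by exact: cvg_snd.
apply: cvgD; first exact: cvg_cst.
apply: cvgD; apply: cvgM => //; apply: cvgB => //; exact: cvg_cst.
Qed.

(** Substituting the Caratheodory slopes of [a] and [b] into the Hadamard factorisation gives a
    slope of the composite that is continuous at [t]. *)
Lemma is_C1_comp {R : realType} {f f1 f2 : R * R -> R} {a b : R -> R}
    {t a' b' : R} : is_C1 f f1 f2 -> is_derive t 1 a a' -> is_derive t 1 b b' ->
  is_derive t 1 (fun s => f (a s, b s))
    (a' * f1 (a t, b t) + b' * f2 (a t, b t)).
Proof.
move=> C1f da db.
have ca := derive_continuous da; have cb := derive_continuous db.
have [A [B [cA cB <- <- fE]]] := is_C1_Hadamard (a t, b t) C1f.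
have /is_derive1_caratheodory[al [alE cal <-]] := da.
have /is_derive1_caratheodory[be [beE cbe <-]] := db.
have cab (k : R * R -> R) : {for (a t, b t), continuous k} ->
    k (a s, b s) @[s --> t] --> k (a t, b t).
  move=> ck.
  apply: (@cvg_comp _ _ _ (fun s => (a s, b s)) k _ (nbhs (a t, b t)));
    last exact: ck.
  exact: (cvg_pair (G := nbhs (a t)) (H := nbhs (b t)) ca cb).
apply/is_derive1_caratheodory.
exists (fun s => A (a s, b s) * al s + B (a s, b s) * be s); split.
- by move=> s; rewrite fE /= alE beE; ring.
- by apply: cvgD; apply: cvgM => //; exact: cab.
- by rewrite /= mulrC; congr (_ + _); rewrite mulrC.
Qed.

Lemma is_C1D {R : realType} {f f1 f2 g g1 g2 : R * R -> R} :
  is_C1 f f1 f2 -> is_C1 g g1 g2 ->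
  is_C1 (fun p => f p + g p) (fun p => f1 p + g1 p) (fun p => f2 p + g2 p).
Proof.
move=> [cf1 cf2 df1 df2] [cg1 cg2 dg1 dg2]; split.
- by move=> p; apply: cvgD; [exact: cf1|exact: cg1].
- by move=> p; apply: cvgD; [exact: cf2|exact: cg2].
- by move=> x y; have := df1 x y; have := dg1 x y => ? ?; exact: is_deriveD.
- by move=> x y; have := df2 x y; have := dg2 x y => ? ?; exact: is_deriveD.
Qed.

Lemma is_C1M {R : realType} {f f1 f2 g g1 g2 : R * R -> R} :
  is_C1 f f1 f2 -> is_C1 g g1 g2 ->
  is_C1 (fun p => f p * g p) (fun p => f p * g1 p + g p * f1 p)
    (fun p => f p * g2 p + g p * f2 p).
Proof.
move=> C1f C1g; have cf := is_C1_continuous C1f.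
have cg := is_C1_continuous C1g.
move: C1f C1g => [cf1 cf2 df1 df2] [cg1 cg2 dg1 dg2]; split.
- by move=> p; apply: (cvgD (cvgM (cf p) (cg1 p)) (cvgM (cg p) (cf1 p))).
- by move=> p; apply: (cvgD (cvgM (cf p) (cg2 p)) (cvgM (cg p) (cf2 p))).
- by move=> x y; have := df1 x y; have := dg1 x y => ? ?; exact: is_deriveM.
- by move=> x y; have := df2 x y; have := dg2 x y => ? ?; exact: is_deriveM.
Qed.

(** The second difference over a square of side [h], taken in either order, is [h * h] times [f12]
    at one point and [h * h] times [f21] at another; both points tend to the corner. *)
Lemma Schwarz {R : realType} {f f1 f2 f11 f12 f21 f22 : R * R -> R} :
  is_C1 f f1 f2 -> is_C1 f1 f11 f12 -> is_C1 f2 f21 f22 -> f12 = f21.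
Proof.
move=> [_ _ df1 df2] [_ cf12 _ df12] [cf21 _ df21 _].
apply/funext => -[x y].
have square (h : R) : 0 < h -> exists p q : R * R,
    [/\ x < p.1 < x + h, y < p.2 < y + h, x < q.1 < x + h, y < q.2 < y + h
      & f12 p = f21 q].
  move=> h0; have xh : x < x + h by rewrite ltrDl.
  have yh : y < y + h by rewrite ltrDl.
  have d1 (s : R) : is_derive s 1 (fun s => f (s, y + h) - f (s, y))
      (f1 (s, y + h) - f1 (s, y)).
    by have := df1 s (y + h); have := df1 s y => ? ?; exact: is_deriveB.
  have d2 (s : R) : is_derive s 1 (fun s => f (x + h, s) - f (x, s))
      (f2 (x + h, s) - f2 (x, s)).
    by have := df2 (x + h) s; have := df2 x s => ? ?; exact: is_deriveB.
  have [a [xa ah ea]] := mean_value xh (fun s _ => d1 s).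
  have [b [yb bh eb]] := mean_value (f := fun s => f1 (a, s)) yh
    (fun s _ => df12 a s).
  have [d [yd dh ed]] := mean_value yh (fun s _ => d2 s).
  have [c [xc ch ec]] := mean_value (f := fun s => f2 (s, d)) xh
    (fun s _ => df21 s d).
  exists (a, b), (c, d); split; rewrite /= ?xa ?yb ?xc ?yd //.
  have hE (z : R) : z + h - z = h by rewrite addrC addKr.
  move: ea ed; rewrite eb ec !hE => ea ed.
  have hh : h * h != 0 by rewrite mulf_neq0// gt_eqF.
  apply: (mulIf hh); rewrite !mulrA -ea -ed; ring.
apply/eqP; rewrite -subr_eq0 -normr_eq0 eq_le normr_ge0 andbT.
apply/ler_addgt0Pr => e e0; rewrite add0r.
have e20 : 0 < e / 2 by rewrite divr_gt0.
have /cvgrPdist_lt/(_ _ e20)/nbhs_ballP[d /= d0 Hd] := cf12 (x, y).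
have /cvgrPdist_lt/(_ _ e20)/nbhs_ballP[d' /= d'0 Hd'] := cf21 (x, y).
have h0 : 0 < Num.min d d' by rewrite lt_min d0.
have [p [q [p1 p2 q1 q2 pq]]] := square _ h0.
have near_ball (k a b : R) : Num.min d d' <= k -> a < b < a + Num.min d d' ->
    `|a - b| < k.
  move=> hk /andP[ab bh]; rewrite distrC gtr0_norm ?subr_gt0//.
  by rewrite ltrBlDl (lt_le_trans bh)// lerD2l.
have hp : ball (x, y) d p.
  by split; apply: near_ball => //; rewrite ge_min lexx.
have hq : ball (x, y) d' q.
  by split; apply: near_ball => //; rewrite ge_min lexx orbT.
have := Hd _ hp; have := Hd' _ hq; rewrite /= pq => A B.
rewrite -[_ - _](subrKA (f21 q)) (le_trans (ler_normD _ _))//.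
rewrite [X in _ + X]distrC [leRHS](splitr e); lra.
Qed.

Lemma is_C1_cst {R : realType} (c : R) :
  is_C1 (fun _ => c) (fun _ => 0) (fun _ => 0).
Proof.
split; [by move=> p; exact: cvg_cst|by move=> p; exact: cvg_cst| |];
  by move=> x y; exact: is_derive_cst.
Qed.

(** * Planar curl-free fields *)

(** With [k c] the maximum of [k] on [0, 1], the function g(t)^2 exp(- 2 k(c) t) is nonincreasing,
    nonnegative and zero at 0. *)
Lemma linear_ode_zero {R : realType} (g k : R -> R) :
  (forall t : R, 0 <= t <= 1 -> is_derive t 1 g (k t * g t)) ->
  (forall t : R, 0 <= t <= 1 -> {for t, continuous k}) ->
  g 0 = 0 -> g 1 = 0.
Proof.
move=> dg ck g0.
have ck' : {within `[0, 1], continuous k}.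
  by apply: continuous_in_subspaceT => t; rewrite inE/= in_itv/=; exact: ck.
have [c _ kc] := EVT_max ler01 ck'.
pose G (t : R) := - (g t ^+ 2 * expR (- (2 * k c) * t)).
have dG (t : R) : 0 <= t <= 1 ->
    is_derive t 1 G (2 * (k c - k t) * (g t ^+ 2 * expR (- (2 * k c) * t))).
  move=> t01; have := dg t t01 => dgt.
  rewrite /G; apply: is_derive_eq.
  rewrite /GRing.scale /=. ring.
have G01 : G 0 <= G 1.
  apply: (derive_ge0_le ler01 dG) => t /andP[t0 t1] /=.
  have /kc kt : t \in `[0, 1]%R by rewrite in_itv/= !ltW.
  apply: mulr_ge0; first by rewrite mulr_ge0 ?subr_ge0 ?ler0n.
  by apply: mulr_ge0; [exact: sqr_ge0|exact: expR_ge0].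
move: G01; rewrite /G g0 expr0n mul0r oppr0 oppr_ge0.
rewrite pmulr_lle0 ?expR_gt0// => g1.
by apply/eqP; rewrite -sqrf_eq0 eq_le g1 sqr_ge0.
Qed.

Lemma polar {R : realType} (p : R * R) :
  exists t, p = (enorm p * cos t, enorm p * sin t).
Proof.
case: p => x y; rewrite /enorm /=; set r := Num.sqrt _.
have r2 : r ^+ 2 = x ^+ 2 + y ^+ 2 by rewrite sqr_sqrtr// addr_ge0 ?sqr_ge0.
have r0 : 0 <= r := sqrtr_ge0 _.
have [r_eq0|r_neq0] := eqVneq r 0.
  exists 0; move/eqP: r2; rewrite r_eq0 expr0n eq_sym paddr_eq0 ?sqr_ge0//.
  by rewrite !sqrf_eq0 !mul0r => /andP[/eqP-> /eqP->].
have rgt0 : 0 < r by rewrite lt0r r_neq0.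
have xr : -1 <= x / r <= 1.
  rewrite -ler_norml normrM normfV (gtr0_norm rgt0) ler_pdivrMr// mul1r.
  by rewrite -(ger0_norm r0) -ler_sqr ?nnegrE// !real_normK ?num_real// r2 lerDl sqr_ge0.
have cE : r * cos (acos (x / r)) = x.
  by rewrite acosK ?in_itv//= mulrC divfK.
have sE : (r * sin (acos (x / r))) ^+ 2 = y ^+ 2.
  have e : r ^+ 2 * cos (acos (x / r)) ^+ 2 = x ^+ 2 by rewrite -exprMn cE.
  rewrite exprMn; have := cos2Dsin2 (acos (x / r)) => /(congr1 ( *%R (r ^+ 2))).
  by rewrite mulrDr e mulr1 r2 => /addrI.
move/eqP: sE; rewrite eqf_sqr => /orP[]/eqP sE.
  by exists (acos (x / r)); rewrite cE sE.
by exists (- acos (x / r)); rewrite cosN sinN mulrN sE cE opprK.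
Qed.

Section PlanarField.
Context {R : realType} (w1 w2 h11 h12 h22 : R * R -> R).
Hypothesis C1w1 : is_C1 w1 h11 h12.
Hypothesis C1w2 : is_C1 w2 h12 h22.
Let rho (p : R * R) : R := w1 p * w1 p + w2 p * w2 p + -1.
Hypothesis C1div : is_C1 (fun p => h11 p + h22 p) (fun p => rho p * w1 p)
  (fun p => rho p * w2 p).
Hypothesis w_eq0 : forall p, w1 p = 0 -> w2 p = 0 -> p = (0, 0).
Hypothesis w1_0 : w1 (0, 0) = 0.
Hypothesis w2_0 : w2 (0, 0) = 0.

(** Schwarz for div w equates d2(rho w1) with d1(rho w2). The terms rho [h12] cancel, and grad rho =
    2 H w leaves H w x w = 0. *)
Lemma gradient_eigenvector p :
  (h11 p * w1 p + h12 p * w2 p) * w2 p = (h12 p * w1 p + h22 p * w2 p) * w1 p.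
Proof.
have C1rho := is_C1D (is_C1D (is_C1M C1w1 C1w1) (is_C1M C1w2 C1w2))
  (is_C1_cst (-1)).
have /(congr1 (fun k => k p)) /= :=
  Schwarz C1div (is_C1M C1rho C1w1) (is_C1M C1rho C1w2).
lra.
Qed.

(* Decomposing (a, b) along w and its normal, H w parallel to w turns the
   derivative of w x (a, b) along the segment into a multiple of w x (a, b). *)
Lemma segment_parallel (x y a b : R) :
  (forall t : R, 0 <= t <= 1 -> (x + t * a, y + t * b) != (0, 0)) ->
  w1 (x, y) * b = w2 (x, y) * a ->
  w1 (x + a, y + b) * b = w2 (x + a, y + b) * a.
Proof.
move=> seg0 par.
have affine (z c t : R) : is_derive t 1 (fun t => z + t * c) c.
  apply: is_derive_eq; rewrite /GRing.scale /=; ring.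
pose line (t : R) := (x + t * a, y + t * b).
have cline (f : R * R -> R) : continuous f -> continuous (fun t => f (line t)).
  move=> cf t.
  apply: (@cvg_comp _ _ _ line f _ (nbhs (line t))); last exact: cf.
  exact: (cvg_pair (G := nbhs (x + t * a)) (H := nbhs (y + t * b))
    (derive_continuous (affine x a t)) (derive_continuous (affine y b t))).
have cw1 := cline _ (is_C1_continuous C1w1).
have cw2 := cline _ (is_C1_continuous C1w2).
have [/cline c11 /cline c12 _ _] := C1w1.
have [_ /cline c22 _ _] := C1w2.
pose n p := w1 p * w1 p + w2 p * w2 p.
(* With A = w.(a, b) and B = w x (a, b), the derivative of B times n^2 is A B (2 w.Hw - n tr H) +
   (A^2 - B^2) (Hw x w). The last term vanishes, and [k] is the factor left in front of B. *)
pose k p := (w1 p * a + w2 p * b)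
  * (2 * (h11 p * (w1 p * w1 p) + 2 * h12 p * (w1 p * w2 p) +
     h22 p * (w2 p * w2 p)) - (h11 p + h22 p) * n p) * (n p * n p)^-1.
have n0 (t : R) : 0 <= t <= 1 -> n (line t) != 0.
  move=> /seg0; apply: contra_neq => /eqP.
  by rewrite paddr_eq0 -?expr2 ?sqr_ge0// !sqrf_eq0 => /andP[/eqP ? /eqP ?]; exact: w_eq0.
pose g t := w1 (line t) * b - w2 (line t) * a.
suff : g 1 = 0 by rewrite /g /line !mul1r => /eqP; rewrite subr_eq0 => /eqP.
apply: (@linear_ode_zero _ g (fun t => k (line t))).
- move=> t t01.
  have d1 := is_C1_comp C1w1 (affine x a t) (affine y b t).
  have d2 := is_C1_comp C1w2 (affine x a t) (affine y b t).
  rewrite /g; apply: is_derive_eq; rewrite /GRing.scale /= -/(line t).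
  have := n0 t t01; have := gradient_eigenvector (line t).
  rewrite /k; move: (line t) => p {g par seg0} E.
  set N := n p => n0'; apply: (mulIf (mulf_neq0 n0' n0')).
  rewrite [RHS]mulrAC (divfK (mulf_neq0 n0' n0')).
  have NE : N = w1 p * w1 p + w2 p * w2 p by [].
  pose A := w1 p * a + w2 p * b; pose B := w1 p * b - w2 p * a.
  transitivity (A * B * (2 * (h11 p * (w1 p * w1 p) + 2 * h12 p * (w1 p * w2 p)
    + h22 p * (w2 p * w2 p)) - (h11 p + h22 p) * N) + (A ^+ 2 - B ^+ 2) *
    ((h11 p * w1 p + h12 p * w2 p) * w2 p -
     (h12 p * w1 p + h22 p * w2 p) * w1 p)).
    by rewrite NE /A /B; ring.
  by rewrite E /A /B; ring.
- move=> t /n0 nt.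
  have cD (f h : R -> R) : {for t, continuous f} -> {for t, continuous h} ->
    {for t, continuous (fun t => f t + h t)} by exact: cvgD.
  have cM (f h : R -> R) : {for t, continuous f} -> {for t, continuous h} ->
    {for t, continuous (fun t => f t * h t)} by exact: cvgM.
  have cC (c : R) : {for t, continuous (fun=> c)} by exact: cvg_cst.
  have cN (f : R -> R) : {for t, continuous f} ->
    {for t, continuous (fun t => - f t)} by exact: cvgN.
  have cI (f : R -> R) : f t != 0 -> {for t, continuous f} ->
    {for t, continuous (fun t => (f t)^-1)} by exact: cvgV.
  have [a1 a2 a3 a4 a5] := And5 (cw1 t) (cw2 t) (c11 t) (c12 t) (c22 t).
  rewrite /k /n; repeat first [assumption | apply: (cC _)
    | apply: (cD _ _) | apply: (cM _ _) | apply: (cN _)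
    | apply: (cI _); first exact: mulf_neq0].
- by rewrite /g /line /= !mul0r !addr0 par subrr.
Qed.
Lemma parallel_to_position (x y : R) : w1 (x, y) * y = w2 (x, y) * x.
Proof.
apply/eqP/negPn/negP; set v1 := w1 (x, y); set v2 := w2 (x, y) => nopar.
have affine (z c t : R) : is_derive t 1 (fun t => z + t * c) c.
  apply: is_derive_eq; rewrite /GRing.scale /=; ring.
(* [l] is the cross product with v: it vanishes at the origin and equals [c] on the tangent line
   through (x, y), so [c != 0] says that this line misses the origin. *)
pose l (p : R * R) := p.1 * v2 - p.2 * v1; pose c := l (x, y).
have c0 : c != 0.
  by rewrite /c /l/= subr_eq0 mulrC; apply: contra_neq nopar => ->; rewrite mulrC.
have v_neq0 : v1 * v1 + v2 * v2 != 0.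
  apply: contra_neq c0 => /eqP; rewrite paddr_eq0 -?expr2 ?sqr_ge0//.
  by rewrite !sqrf_eq0 /c /l => /andP[/eqP-> /eqP->]; rewrite !mulr0 subrr.
have l_neq0 p : l p != 0 -> p != (0, 0).
  by apply: contra_neq => ->; rewrite /l/= !mul0r subrr.
have on_line p : l p = c -> w1 p * v2 = w2 p * v1.
  case: p => a b lp.
  pose t := ((a - x) * v1 + (b - y) * v2) / (v1 * v1 + v2 * v2).
  have lpE : (a - x) * v2 = (b - y) * v1 by move: lp; rewrite /c /l/=; lra.
  have tE : t * (v1 * v1 + v2 * v2) = (a - x) * v1 + (b - y) * v2.
    by rewrite /t divfK.
  have aE : a = x + t * v1.
    apply: (mulIf v_neq0); rewrite [RHS]mulrDl [t * v1 * _]mulrAC tE.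
    have : ((a - x) * v2) * v2 = (b - y) * v1 * v2 by rewrite lpE.
    lra.
  have bE : b = y + t * v2.
    apply: (mulIf v_neq0); rewrite [RHS]mulrDl [t * v2 * _]mulrAC tE.
    have : ((a - x) * v2) * v1 = (b - y) * v1 * v1 by rewrite lpE.
    lra.
  case: (eqVneq t 0) => [t0|t0].
    by rewrite aE bE t0 !mul0r !addr0 mulrC.
  have := @segment_parallel x y (t * v1) (t * v2).
  rewrite -aE -bE -/v1 -/v2 !(mulrCA _ t) => /(_ _ _)/(mulfI t0); apply.
    move=> s _; apply: l_neq0; rewrite (_ : l _ = c)// /l /c /l/=; ring.
  by rewrite [v1 * v2]mulrC.
(* The line through [p] along [w p] would meet the line [l = c], on which [w]
   is parallel to [v]. *)
have half_plane p : 0 < l p * c -> w1 p * v2 = w2 p * v1.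
  move=> lp; apply/eqP/negPn/negP => nop.
  set u1 := w1 p in nop; set u2 := w2 p in nop.
  have d0 : u1 * v2 - u2 * v1 != 0 by rewrite subr_eq0.
  (* Solves l(p + s w(p)) = c, so that [z] is the crossing point with the line [l = c]. *)
  pose s := (c - l p) / (u1 * v2 - u2 * v1).
  have sE : s * (u1 * v2 - u2 * v1) = c - l p by rewrite /s divfK.
  pose z := (p.1 + s * u1, p.2 + s * u2).
  have lz : l z = c by rewrite -[RHS](subrK (l p)) -sE /z /l/=; ring.
  have zpar := on_line _ lz.
  case: (eqVneq s 0) => [s0|s0].
    move/eqP: nop; apply; rewrite /u1 /u2.
    have <- // : z = p by rewrite /z s0 !mul0r !addr0; case: (p).
  have := @segment_parallel p.1 p.2 (s * u1) (s * u2).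
  rewrite -/z -surjective_pairing -/u1 -/u2 !(mulrCA _ s) => /(_ _ _)/(mulfI s0) zu.
  have {}zu : w1 z * u2 = w2 z * u1.
    apply: zu => [t /andP[t0 t1]|]; last by rewrite [u1 * u2]mulrC.
    apply: l_neq0; have : 0 < l (p.1 + t * (s * u1), p.2 + t * (s * u2)) * c.
      have -> : l (p.1 + t * (s * u1), p.2 + t * (s * u2)) =
          l p + t * (s * (u1 * v2 - u2 * v1)) by rewrite /l/=; ring.
      rewrite sE; have := c0; rewrite -sqrf_eq0 => c2.
      have {}c2 : 0 < c ^+ 2 by rewrite lt0r c2 sqr_ge0.
      (* Along the segment, l c = (1 - t) l(p) c + t c^2 > 0, so the origin is avoided; the case
         split keeps one of the two weights at least 1/2. *)
      have [t12|t12] := lerP t (2^-1); first by nra.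
      by nra.
    by apply: contraTneq => ->; rewrite mul0r ltxx.
  have : z != (0, 0) by apply: l_neq0; rewrite lz.
  (* w(z) is parallel to both v and w(p), which are independent, so it is 0 although z is not the
     origin. *)
  move/eqP; apply; apply: w_eq0; apply: (mulIf d0); rewrite mul0r mulrBr.
    rewrite [X in X - _]mulrCA zpar [X in _ - X]mulrA zu; ring.
  rewrite [X in _ - X]mulrCA -zpar [X in X - _]mulrA -zu; ring.
(* [e] is normal to [v] and points into the half-plane. *)
pose e1 := c * v2; pose e2 := - (c * v1).
have le (s : R) : l (0 + s * e1, 0 + s * e2) * c = s * (c ^+ 2 * (v1 * v1 + v2 * v2)).
  by rewrite /l /e1 /e2/=; ring.
have pos : 0 < c ^+ 2 * (v1 * v1 + v2 * v2).
  rewrite lt0r mulf_neq0 ?sqrf_eq0//=.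
  by rewrite mulr_ge0 ?sqr_ge0// addr_ge0// -expr2 sqr_ge0.
pose k (s : R) := w1 (0 + s * e1, 0 + s * e2) * v1 + w2 (0 + s * e1, 0 + s * e2) * v2.
have dk (s : R) : is_derive s 1 k
   ((e1 * h11 (0 + s * e1, 0 + s * e2) + e2 * h12 (0 + s * e1, 0 + s * e2)) * v1 +
    (e1 * h12 (0 + s * e1, 0 + s * e2) + e2 * h22 (0 + s * e1, 0 + s * e2)) * v2).
  have d1 := is_C1_comp C1w1 (affine 0 e1 s) (affine 0 e2 s).
  have d2 := is_C1_comp C1w2 (affine 0 e1 s) (affine 0 e2 s).
  by rewrite /k; apply: is_derive_eq; rewrite /GRing.scale /=; ring.
(* As w vanishes at the origin, w.v at the end of the normal is its derivative at some [p] on it.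
   Symmetry of H makes this [c] times the derivative of w x v along v, and [half_plane] makes w x v
   vanish on the parallel to v through [p]. So w at the end is both orthogonal and parallel to v. *)
have [s [s0 s1]] := mean_value ltr01 (fun s _ => dk s).
set p := (0 + s * e1, 0 + s * e2).
have d1 := is_C1_comp C1w1 (affine p.1 v1 0) (affine p.2 v2 0).
have d2 := is_C1_comp C1w2 (affine p.1 v1 0) (affine p.2 v2 0).
rewrite !mul0r !addr0 -surjective_pairing in d1 d2.
have : is_derive (0 : R) 1 (fun t => w1 (p.1 + t * v1, p.2 + t * v2) * v2 -
   w2 (p.1 + t * v1, p.2 + t * v2) * v1)
   ((v1 * h11 p + v2 * h12 p) * v2 - (v1 * h12 p + v2 * h22 p) * v1).
  by apply: is_derive_eq; rewrite /GRing.scale /=; ring.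
have -> : (fun t => w1 (p.1 + t * v1, p.2 + t * v2) * v2 -
   w2 (p.1 + t * v1, p.2 + t * v2) * v1) = cst 0.
  apply/funext => t; apply/eqP; rewrite subr_eq0; apply/eqP; apply: half_plane.
  have -> : l (p.1 + t * v1, p.2 + t * v2) = l p by rewrite /l/=; ring.
  by rewrite le mulr_gt0.
move=> /(@derive_val _ _ _ _ _ _ _); rewrite derive_cst => dE.
have -> : (e1 * h11 p + e2 * h12 p) * v1 + (e1 * h12 p + e2 * h22 p) * v2 =
  c * ((v1 * h11 p + v2 * h12 p) * v2 - (v1 * h12 p + v2 * h22 p) * v1).
  by rewrite /e1 /e2; ring.
rewrite -dE mulr0 mul0r => /eqP; rewrite subr_eq0 => /eqP.
have par1 := half_plane (0 + 1 * e1, 0 + 1 * e2).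
rewrite le mul1r in par1; move: (par1 pos) => {}par1.
have lE : l (0 + 1 * e1, 0 + 1 * e2) != 0.
  apply: contra_eq_neq (le 1) => ->; rewrite mul0r mul1r eq_sym; exact: lt0r_neq0.
rewrite /k !mul0r !addr0 w1_0 w2_0 !mul0r addr0.
move: (l_neq0 _ lE) par1; move: (0 + _, 0 + _) => q /eqP q0 A B; apply: q0.
apply: w_eq0; apply: (mulIf v_neq0); rewrite mul0r mulrDr !mulrA.
  by rewrite A -[RHS](mul0r v1) -B; ring.
by rewrite -A -[RHS](mul0r v2) -B; ring.
Qed.

(** Along the circle through [p], w.x has derivative T.Hx + w.T with T = (-y, x). Both terms vanish
    since x and H w are parallel to w, so w.x keeps its value at (|p|, 0). *)
Lemma radial_form (p : R * R) :
  enorm p * w1 p = w1 (enorm p, 0) * p.1 /\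
  enorm p * w2 p = w1 (enorm p, 0) * p.2.
Proof.
have r0 : 0 <= enorm p := sqrtr_ge0 _.
have r2 : enorm p ^+ 2 = p.1 ^+ 2 + p.2 ^+ 2.
  by rewrite sqr_sqrtr// addr_ge0 ?sqr_ge0.
have [t] := polar p; move: r0 r2; set r := enorm p => r0 r2.
have [->|r_neq0] := eqVneq r 0; first by rewrite !mul0r w1_0 => _; rewrite !mul0r.
pose a (t : R) := r * cos t; pose b (t : R) := r * sin t.
have da (t' : R) : is_derive t' 1 a (- b t').
  apply: is_derive_eq; rewrite /GRing.scale /= /b; ring.
have db (t' : R) : is_derive t' 1 b (a t').
  apply: is_derive_eq; rewrite /GRing.scale /= /a; ring.
pose m t := w1 (a t, b t) * a t + w2 (a t, b t) * b t.
have dm (t' : R) : is_derive t' 1 m 0.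
  have d1 := is_C1_comp C1w1 (da t') (db t').
  have d2 := is_C1_comp C1w2 (da t') (db t').
  have := da t'; have := db t' => ? ?.
  rewrite /m; apply: is_derive_eq; rewrite /GRing.scale /=.
  have := parallel_to_position (a t') (b t').
  have := gradient_eigenvector (a t', b t').
  have : (a t', b t') != (0, 0).
    apply: contra_neq r_neq0 => -[a0 b0].
    apply/eqP; rewrite -sqrf_eq0 -[_ ^+ 2]mulr1 -(cos2Dsin2 t') mulrDr -!exprMn.
    by rewrite -/(a t') -/(b t') a0 b0 expr0n addr0.
  move/eqP; move: (a t') (b t') => x y xy0 E par.
  have : w1 (x, y) * w1 (x, y) + w2 (x, y) * w2 (x, y) != 0.
    apply/eqP => /eqP; rewrite paddr_eq0 -?expr2 ?sqr_ge0// !sqrf_eq0.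
    by move=> /andP[/eqP A /eqP B]; apply: xy0; exact: w_eq0.
  move: xy0 E par => _; set p1 := w1 _; set p2 := w2 _; set q1 := h11 _.
  set q2 := h12 _; set q3 := h22 _ => E par n0.
  (* This is T.Hx. Multiplying it by [p1 * p1] or [p2 * p2] lets [par] trade x for w; the two
     factors have a nonzero sum. *)
  pose B := (- y * q1 + x * q2) * x + (- y * q2 + x * q3) * y.
  have B1 : p1 * p1 * B = 0.
    transitivity (- (p1 * y) * x * p1 * q1 + (x * p1) ^+ 2 * q2 -
      (p1 * y) ^+ 2 * q2 + x * p1 * (p1 * y) * q3); first by rewrite /B; ring.
    rewrite par; transitivity (x ^+ 2 * ((q2 * p1 + q3 * p2) * p1
      - (q1 * p1 + q2 * p2) * p2)); first by ring.
    by rewrite E subrr mulr0.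
  have B2 : p2 * p2 * B = 0.
    transitivity (- y * p2 * (p2 * x) * q1 + (p2 * x) ^+ 2 * q2 -
      (p2 * y) ^+ 2 * q2 + (p2 * x) * p2 * y * q3); first by rewrite /B; ring.
    rewrite -par; transitivity (y ^+ 2 * ((q2 * p1 + q3 * p2) * p1
      - (q1 * p1 + q2 * p2) * p2)); first by ring.
    by rewrite E subrr mulr0.
  have B0 : B = 0.
    by apply: (mulfI n0); rewrite mulr0 mulrDl B1 B2 addr0.
  transitivity (B + (p2 * x - p1 * y)); first by rewrite /B; ring.
  by rewrite B0 par subrr addr0.
move=> pE; have := @is_derive_0_is_cst _ m t 0 dm.
rewrite /m /a /b cos0 sin0 !mulr1 !mulr0 addr0 -pE.
have [-> ->] : r * cos t = p.1 /\ r * sin t = p.2 by rewrite pE.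
have := parallel_to_position p.1 p.2; rewrite -surjective_pairing.
move: (w1 p) (w2 p) (w1 (r, 0)) => p1 p2 F par E.
split; apply: (mulfI r_neq0).
  have -> : r * (r * p1) = r ^+ 2 * p1 by ring.
  have -> : r * (F * p.1) = F * r * p.1 by ring.
  rewrite r2 -E; transitivity (p1 * p.1 * p.1 + (p1 * p.2) * p.2); first by ring.
  by rewrite par; ring.
have -> : r * (r * p2) = r ^+ 2 * p2 by ring.
have -> : r * (F * p.2) = F * r * p.2 by ring.
rewrite r2 -E; transitivity ((p2 * p.1) * p.1 + p2 * p.2 * p.2); first by ring.
by rewrite -par; ring.
Qed.

(** * The field along the first axis *)

Lemma w2_axis (r : R) : r != 0 -> w2 (r, 0) = 0.
Proof.
move=> r0; have := parallel_to_position r 0; rewrite mulr0 => /esym/eqP.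
by rewrite mulf_eq0 (negbTE r0) orbF => /eqP.
Qed.

(* Differentiate [w1 (r, s) * s = w2 (r, s) * r] in [s] at 0. *)
Lemma h22_axis (r : R) : h22 (r, 0) * r = w1 (r, 0).
Proof.
have [_ _ _ d1] := C1w1; have [_ _ _ d2] := C1w2.
have d1' := d1 r 0; have d2' := d2 r 0.
have : is_derive (0 : R) 1 (fun s => w1 (r, s) * s - w2 (r, s) * r)
    (w1 (r, 0) - h22 (r, 0) * r).
  by apply: is_derive_eq; rewrite /GRing.scale /=; ring.
have -> : (fun s => w1 (r, s) * s - w2 (r, s) * r) = cst 0.
  by apply/funext => s; rewrite parallel_to_position subrr.
move=> /(@derive_val _ _ _ _ _ _ _); rewrite derive_cst => /esym/eqP.
by rewrite subr_eq0 => /eqP.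
Qed.

Let F r := w1 (r, 0).
(** By [h22_axis] this is h11 for r > 0; in this form only div w and F need differentiating, and
    [C1div] differentiates div w. *)
Let Fp r := h11 (r, 0) + h22 (r, 0) - w1 (r, 0) / r.

Lemma profile_derive (r : R) : 0 < r -> is_derive r 1 F (Fp r).
Proof.
move=> r0; have [_ _ d1 _] := C1w1; have d1' := d1 r 0.
apply: is_derive_eq; rewrite /Fp -h22_axis mulfK ?addrK//.
exact: lt0r_neq0.
Qed.

Lemma profile_derive2 (r : R) : 0 < r -> is_derive r 1 Fp
  (F r / r ^+ 2 - Fp r / r + F r * (F r ^+ 2 - 1)).
Proof.
move=> r0; have dF := profile_derive _ r0; have [_ _ d _] := C1div.
have d' := d r 0; have rn0 : r != 0 by exact: lt0r_neq0.
have dV : is_derive r 1 (fun s : R => s^-1) (- r ^- 2 *: 1).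
  exact: (is_deriveV (f := id) rn0 (is_derive_id r 1)).
rewrite /Fp; apply: is_derive_eq; rewrite /rho w2_axis// -/(F r) /GRing.scale /= -/(Fp r).
by rewrite /F; field.
Qed.

Lemma profile_bound : exists2 K, 0 < K &
  forall r : R, 0 < r <= 1 -> `|F r| <= K * r /\ `|Fp r| <= K.
Proof.
have [ch _ d _] := C1w1.
have ch' : {within `[0, 1], continuous (fun r : R => `|h11 (r, 0)|)}.
  apply: continuous_subspaceT => r; apply: cvg_norm.
  apply: (@cvg_comp _ _ _ (fun r => (r, 0)) h11 _ (nbhs (r, 0))); last exact: ch.
  exact: (cvg_pair (G := nbhs r) (H := nbhs 0) cvg_id (cvg_cst _)).
have [c _ hc] := EVT_max ler01 ch'.
exists (`|h11 (c, 0)| + 1); first by rewrite ltr_wpDl.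
move=> r /andP[r0 r1].
have hb (s : R) : 0 <= s <= r -> `|h11 (s, 0)| <= `|h11 (c, 0)| + 1.
  move=> /andP[s0 sr]; rewrite (le_trans (hc s _)) ?lerDl//.
  by rewrite in_itv/= s0 (le_trans sr).
split; last first.
  have -> : Fp r = h11 (r, 0).
    by rewrite /Fp -h22_axis mulfK ?addrK//; exact: lt0r_neq0.
  by apply: hb; rewrite lexx ltW.
have [s [s0 sr]] := mean_value r0 (fun s _ => d s 0).
rewrite w1_0 !subr0 /F => ->; rewrite normrM (gtr0_norm r0) ler_pM2r//.
by apply: hb; rewrite !ltW.
Qed.

(** On the positive axis w2 = 0, so a zero of F would be a second zero of w; by the intermediate
    value theorem F keeps the sign of F(1). *)
Lemma profile_sign : exists eps, (eps = 1 \/ eps = -1) /\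
  forall r : R, 0 < r -> 0 < eps * F r.
Proof.
have F0 (r : R) : 0 < r -> F r != 0.
  move=> r0; apply: contraTneq (r0) => Fr.
  by have [->] := w_eq0 _ Fr (w2_axis _ (lt0r_neq0 r0)); rewrite ltxx.
exists (Num.sg (F 1)); split.
  by have := F0 1 ltr01; case: sgrP => [|_ _|_ _] //; [left|right].
move=> r r0; rewrite ltNge; apply/negP => neg.
have prod : F 1 * F r <= 0.
  rewrite [F 1]numEsg -mulrA mulrCA mulr_ge0_le0 ?normr_ge0//.
have [_ _ d _] := C1w1.
have cF (a b : R) : {within `[a, b], continuous F}.
  by apply: continuous_subspaceT => s; exact: derive_continuous (d s 0).
have zero (a b : R) : 0 < a -> a <= b -> F a * F b <= 0 ->
    exists2 c, 0 < c & F c = 0.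
  move=> a0 ab Fab; have [|c] := @IVT R F a b 0 ab (cF a b).
    rewrite ge_min le_max !leNgt -!negb_and.
    by apply/andP; split; apply/negP => /andP[? ?]; nra.
  by rewrite in_itv/= => /andP[ac _] Fc; exists c => //; exact: lt_le_trans ac.
have [c c0 Fc] : exists2 c, 0 < c & F c = 0.
  have [r1|/ltW r1] := lerP 1 r; first exact: (zero 1 r).
  by apply: (zero r 1) => //; rewrite mulrC.
by have := F0 c c0; rewrite Fc eqxx.
Qed.

End PlanarField.

(** * Uniqueness of the radial profile *)

(** Before the first time at which y <= 0, V is nondecreasing, hence nonnegative, so y is
    nondecreasing and stays above y(a) > 0: that time never comes. In the uses V is the Wronskian
    and y the quotient minus 1, up to sign and reflection. *)
Lemma forward_invariance {R : realType} (y V dy dV : R -> R) (a b : R) :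
  a <= b ->
  (forall t : R, a <= t <= b -> is_derive t 1 y (dy t)) ->
  (forall t : R, a <= t <= b -> is_derive t 1 V (dV t)) ->
  (forall t, a <= t <= b -> 0 <= V t -> 0 <= dy t) ->
  (forall t, a <= t <= b -> 0 < y t -> 0 <= dV t) ->
  0 < y a -> 0 <= V a -> y a <= y b /\ V a <= V b.
Proof.
move=> ab hy hV Vdy ydV ya Va.
have sub (c t : R) : c <= b -> a <= t <= c -> a <= t <= b.
  by move=> cb /andP[-> tc]; exact: le_trans cb.
have ltW2 (c t : R) : a < t < c -> a <= t <= c by move=> /andP[? ?]; rewrite !ltW.
have mono (c : R) : a <= c -> c <= b -> (forall t, a <= t -> t < c -> 0 < y t) ->
    y a <= y c /\ V a <= V c.
  move=> ac cb ypos.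
  have Vmono (d : R) : a <= d <= c -> V a <= V d.
    move=> /andP[ad dc]; apply: (derive_ge0_le ad) => t tad.
      by apply: hV; apply: (sub d) => //; exact: le_trans cb.
    have /andP[at' td] := tad.
    apply: ydV; last by apply: ypos; [exact: ltW|exact: lt_le_trans dc].
    by apply: (sub d); [exact: le_trans cb|exact: ltW2].
  split; last by apply: Vmono; rewrite ac lexx.
  apply: (derive_ge0_le ac) => t tac; first by apply: hy; exact: sub tac.
  apply: Vdy; first by apply: (sub c) => //; exact: ltW2.
  by rewrite (le_trans Va)// Vmono// ltW2.
suff ypos : forall t, a <= t -> t <= b -> 0 < y t.
  by apply: mono => // t at' tb; apply: ypos => //; exact: ltW.
move=> t1 at1 t1b; rewrite ltNge; apply/negP => yt1.
pose S := [set t | a <= t <= b /\ y t <= 0].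
have Sinf : has_inf S.
  split; first by exists t1; rewrite /S/= at1 t1b.
  by exists a => t [/andP[]].
have aS : a <= inf S by apply: lb_le_inf => [|t [/andP[]]//]; exact: Sinf.1.
have St1 : inf S <= t1 by apply: ge_inf; [exact: Sinf.2|rewrite /S/= at1 t1b].
have Sb : inf S <= b := le_trans St1 t1b.
have yS : y (inf S) <= 0.
  rewrite leNgt; apply/negP => yS.
  have cy : {for inf S, continuous y} by apply: derive_continuous (hy _ _); rewrite aS.
  have /cvgrPdist_lt/(_ _ yS)/nbhs_ballP[e /= e0 He] := cy.
  have [s [/andP[as' sb] ys] sS] := inf_adherent e0 Sinf.
  have Ss : inf S <= s by apply: ge_inf; [exact: Sinf.2|rewrite /S/= as' sb].
  have /He : ball (inf S) e s.
    by rewrite /ball/= distrC ger0_norm ?subr_ge0// ltrBlDl.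
  rewrite /= => /(le_lt_trans (ler_norm _)); rewrite ltrBlDl ltrDr.
  by rewrite ltNge ys.
have [] := mono _ aS Sb; last by rewrite leNgt (le_lt_trans yS).
move=> t at' tS; rewrite ltNge; apply/negP => yt.
have : inf S <= t.
  by apply: ge_inf; [exact: Sinf.2|rewrite /S/= at' (le_trans (ltW tS))].
by rewrite leNgt tS.
Qed.

(** h - c ln is nondecreasing, so h(r) > B once c ln r exceeds B - h(a) + c ln a; the witness takes
    this threshold for ln r with a margin 1. *)
Lemma log_growth {R : realType} (h dh : R -> R) (a c B : R) : 0 < a -> 0 < c ->
  (forall r : R, a <= r -> is_derive r 1 h (dh r)) ->
  (forall r, a <= r -> c / r <= dh r) ->
  exists2 M, a <= M & forall r, M <= r -> B < h r.
Proof.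
move=> a0 c0 dh' hc.
exists (Num.max a (expR ((B - h a) / c + ln a + 1))); first by rewrite le_max lexx.
move=> r; rewrite ge_max => /andP[ar er].
have rgt0 : 0 < r by exact: lt_le_trans ar.
have : h a - c * ln a <= h r - c * ln r.
  apply: (@derive_ge0_le _ (fun s => h s - c * ln s) (fun s => dh s - c / s) a r ar).
    move=> s /andP[as' sr]; have s0 := lt_le_trans a0 as'.
    have := dh' s as'; have := is_derive1_ln s0 => ? ?.
    by apply: is_derive_eq; rewrite /GRing.scale /=; ring.
  by move=> s /andP[as' _]; rewrite subr_ge0 hc// ltW.
have : (B - h a) / c + ln a + 1 <= ln r by rewrite -[leLHS]expRK ler_ln ?posrE ?expR_gt0.
rewrite -(ler_pM2l c0) !mulrDr mulrCA divff ?gt_eqF// !mulr1.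
by have := c0; lra.
Qed.

(** * Two profiles compared through their weighted Wronskian *)

Section ProfileUniqueness.
Context {R : realType} (f fp g gp : R -> R) (K : R).
Hypothesis f_gt0 : forall r, 0 < r -> 0 < f r.
Hypothesis g_ge0 : forall r, 0 < r -> 0 <= g r.
Hypothesis df : forall r : R, 0 < r -> is_derive r 1 f (fp r).
Hypothesis dfp : forall r : R, 0 < r ->
  is_derive r 1 fp (f r / r ^+ 2 - fp r / r + f r * (f r ^+ 2 - 1)).
Hypothesis dg : forall r : R, 0 < r -> is_derive r 1 g (gp r).
Hypothesis dgp : forall r : R, 0 < r ->
  is_derive r 1 gp (g r / r ^+ 2 - gp r / r + g r * (g r ^+ 2 - 1)).
Hypothesis K_gt0 : 0 < K.
Hypothesis f_le : forall r, 0 < r <= 1 -> f r <= K * r.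
Hypothesis fp_le : forall r, 0 < r <= 1 -> `|fp r| <= K.
Hypothesis g_0 : forall e, 0 < e -> exists2 d, 0 < d &
  forall r, 0 < r < d -> g r < e.
Hypothesis g_oo : exists2 M, 0 < M & forall r, M <= r -> 2^-1 <= g r <= 2.
Hypothesis f_oo : forall M, exists2 r, M <= r & 2^-1 <= f r <= 2.

Let V (r : R) := r * (f r * gp r - g r * fp r).
Let dV (r : R) := r * f r * g r * (g r ^+ 2 - f r ^+ 2).
Let q (r : R) := g r / f r.
Let dq (r : R) := V r / (r * f r ^+ 2).

Lemma wronskian_derive (r : R) : 0 < r -> is_derive r 1 V (dV r).
Proof.
move=> r0; have := df r r0; have := dfp r r0; have := dg r r0.
have := dgp r r0 => ? ? ? ?; have rn0 := lt0r_neq0 r0.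
by rewrite /V; apply: is_derive_eq; rewrite /GRing.scale /= /dV; field.
Qed.

Lemma quotient_derive (r : R) : 0 < r -> is_derive r 1 q (dq r).
Proof.
move=> r0; have := df r r0; have := dg r r0 => ? ?.
have rn0 := lt0r_neq0 r0; have fn0 := lt0r_neq0 (f_gt0 _ r0).
have ? := is_deriveV fn0 (df r r0).
rewrite /q; apply: is_derive_eq; rewrite /GRing.scale /= /dq /V.
by field; rewrite fn0.
Qed.

(** [eps] is the sign of V. Since f <= K r, |f'| <= K and g tends to 0, eps V >= c forces eps g' >=
    c / (2 K r) near 0. Over [r, 2 r] this moves g by at least c / (4 K), although g is nonnegative
    and below c / (4 K) there. *)
Lemma wronskian_not_bounded_away_at0 (eps c r0 : R) : `|eps| = 1 -> 0 < c ->
  0 < r0 -> (forall r, 0 < r < r0 -> c <= eps * V r) -> False.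
Proof.
move=> eps1 c0 r00 Vc.
have Kn0 : K != 0 := lt0r_neq0 K_gt0.
have epsN (x : R) : `|eps * x| = `|x| by rewrite normrM eps1 mul1r.
have cK0 : 0 < c / (4 * K) by rewrite divr_gt0// mulr_gt0.
have cK1 : 0 < c / (2 * K) by rewrite divr_gt0// mulr_gt0.
have [d d0 gd] := g_0 _ cK0; have [d' d'0 gd'] := g_0 _ ltr01.
(* Below [m] the bounds on [f] and [fp] hold, g < 1 and r < c / (2 K) make r g |f'| at most c / 2,
   and g < c / (4 K). *)
pose m := Num.min (Num.min r0 1) (Num.min (c / (2 * K)) (Num.min d d')).
have m0 : 0 < m by rewrite !lt_min r00 ltr01 cK1 d0 d'0.
have small s : 0 < s -> s < m -> [/\ s < r0, s < 1, s < c / (2 * K), s < d & s < d'].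
  by move=> s0; rewrite !lt_min => /and3P[/andP[-> ->] -> /andP[-> ->]].
have slope s : 0 < s -> s < m -> c / (2 * K) / s <= eps * gp s.
  move=> s0 /(small _ s0)[sr s1 sc sd sd'].
  have s01 : 0 < s <= 1 by rewrite s0 ltW.
  have /Vc : 0 < s < r0 by rewrite s0.
  have gs1 := gd' s; rewrite s0 sd' in gs1; move: (gs1 isT) => {}gs1.
  have : - (eps * (s * (g s * fp s))) <= c / 2.
    rewrite (le_trans (ler_norm _))// normrN epsN !normrM (gtr0_norm s0).
    rewrite (ger0_norm (g_ge0 _ s0)).
    have -> : c / 2 = c / (2 * K) * K by field.
    apply: ler_pM; [exact: ltW|by rewrite mulr_ge0// g_ge0|exact: ltW|].
    by rewrite -[leRHS]mul1r; apply: ler_pM; rewrite ?g_ge0 ?fp_le// ltW.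
  rewrite /V => A B.
  have C : c / 2 <= s * f s * (eps * gp s).
    by move: A B; rewrite !mulrBr; lra.
  have fs := f_gt0 _ s0; have fK := f_le _ s01.
  have egp : 0 < eps * gp s.
    by rewrite -(pmulr_rgt0 _ (mulr_gt0 s0 fs)) (lt_le_trans _ C)// divr_gt0.
  rewrite ler_pdivrMr// ler_pdivrMr ?mulr_gt0//.
  have D : s * f s * (eps * gp s) <= s * K * (eps * gp s).
    rewrite ler_pM2r// ler_pM2l// (le_trans fK)//.
    by rewrite -[leRHS]mulr1 ler_pM2l// ltW.
  by move: C D; lra.
pose r := m / 3.
have r0' : 0 < r by rewrite divr_gt0.
have r2m : 2 * r < m by rewrite /r; have := m0; lra.
have rr : r < 2 * r by have := r0'; lra.
have rm : r < m := lt_trans rr r2m.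
have [|s [rs s2 E]] := @mean_value _ g gp _ _ rr.
  by move=> t /andP[rt _]; apply: dg; exact: lt_le_trans rt.
have s0 : 0 < s := lt_trans r0' rs.
have := slope _ s0 (lt_trans s2 r2m).
rewrite ler_pdivrMr// => H.
have : c / (4 * K) <= eps * (g (2 * r) - g r).
  rewrite E; have -> : 2 * r - r = r by ring.
  rewrite (_ : c / (4 * K) = c / (2 * K) / 2); last by field.
  rewrite ler_pdivrMr// (le_trans H)//.
  have egp : 0 < eps * gp s by rewrite -(pmulr_lgt0 _ s0) (lt_le_trans _ H).
  have -> : eps * (gp s * r) * 2 = eps * gp s * (2 * r) by ring.
  by rewrite ler_pM2l// ltW.
rewrite leNgt => /negP; apply.
rewrite (le_lt_trans (ler_norm _))// epsN.
have [_ _ _ rd _] := small _ r0' rm.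
have [_ _ _ r2d _] : [/\ 2 * r < r0, 2 * r < 1, 2 * r < c / (2 * K), 2 * r < d & 2 * r < d'].
  by apply: small => //; rewrite mulr_gt0.
have A := gd r; rewrite r0' rd in A; move: (A isT) => {}A.
have B := gd (2 * r); rewrite mulr_gt0// r2d in B; move: (B isT) => {}B.
have := g_ge0 _ r0'; have := g_ge0 (2 * r); rewrite mulr_gt0// => /(_ isT) C D.
by rewrite ltr_norml; apply/andP; split; lra.
Qed.

Lemma wronskian_sign (r : R) : 0 < r ->
  (1 < q r -> 0 <= dV r) /\ (q r < 1 -> dV r <= 0).
Proof.
move=> r0; have fr := f_gt0 _ r0; have gr := g_ge0 _ r0.
rewrite /q /dV ltr_pdivlMr// ltr_pdivrMr// mul1r.
have rfg : 0 <= r * f r * g r by rewrite !mulr_ge0// ltW.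
split=> h; first by rewrite mulr_ge0// subr_ge0 ler_sqr ?nnegrE// ltW.
by rewrite mulr_ge0_le0// subr_le0 ler_sqr ?nnegrE// ltW.
Qed.

Lemma quotient_slope_sign (r : R) : 0 < r ->
  (0 <= V r -> 0 <= dq r) /\ (V r <= 0 -> dq r <= 0).
Proof.
move=> r0; have d0 : 0 < r * f r ^+ 2 by rewrite mulr_gt0// exprn_gt0// f_gt0.
by rewrite /dq; split=> h; [rewrite divr_ge0// ltW|rewrite mulr_le0_ge0// invr_ge0 ltW].
Qed.

(** Suppose q(r0) > 1. If V(r0) < 0, then V is at most V(r0) all the way down to 0, which is
    excluded above. If V(r0) >= 0, then q stays above 1 and grows at least like log r, against the
    radii of [f_oo]. *)
Lemma quotient_le1 (r0 : R) : 0 < r0 -> q r0 <= 1.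
Proof.
move=> r00; rewrite leNgt; apply/negP => q1.
have [V0|V0] := lerP 0 (V r0); last first.
  apply: (@wronskian_not_bounded_away_at0 (-1) (- V r0) r0) => //.
  - by rewrite normrN1.
  - by rewrite oppr_gt0.
  move=> r /andP[rgt0 rr0]; rewrite mulN1r.
  (* The reflection t = -r turns the descent from [r0] to [r] into a forward run. *)
  pose y t := q (- t) - 1; pose W t := - V (- t).
  have pos (t : R) : - r0 <= t <= - r -> 0 < - t.
    by move=> /andP[_ tr]; rewrite oppr_gt0 (le_lt_trans tr)// oppr_lt0.
  have [|||||||_] := @forward_invariance _ y W (fun t => - dq (- t))
    (fun t => dV (- t)) (- r0) (- r); last by rewrite /W !opprK.
  - by rewrite lerN2 ltW.
  - move=> t /pos t0; have := quotient_derive _ t0 => ?.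
    by rewrite /y; apply: is_derive_eq; rewrite subr0 mulrN1.
  - move=> t /pos t0; have := wronskian_derive _ t0 => ?.
    by rewrite /W; apply: is_derive_eq; rewrite mulrN1 opprK.
  - move=> t /pos t0; rewrite /W !oppr_ge0.
    by have [_] := quotient_slope_sign _ t0.
  - move=> t /pos t0; rewrite /y subr_gt0.
    by have [] := wronskian_sign _ t0.
  - by rewrite /y opprK subr_gt0.
  - by rewrite /W opprK oppr_ge0 ltW.
have above a r : 0 < a -> 1 < q a -> 0 <= V a -> a <= r ->
    q a <= q r /\ V a <= V r.
  move=> a0 qa Va ar; have pos (t : R) : a <= t <= r -> 0 < t.
    by move=> /andP[at' _]; exact: lt_le_trans at'.
  have [||||||] := @forward_invariance _ (fun t => q t - 1) V dq dV a r ar.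
  - move=> t /pos t0; have := quotient_derive _ t0 => ?.
    by apply: is_derive_eq; rewrite subr0.
  - by move=> t /pos; exact: wronskian_derive.
  - by move=> t /pos t0; have [] := quotient_slope_sign _ t0.
  - by move=> t /pos t0; rewrite /= subr_gt0; have [] := wronskian_sign _ t0.
  - by rewrite /= subr_gt0.
  - by [].
  - by rewrite /= lerD2r.
have above0 r : r0 <= r -> 1 < q r.
  by move=> /(above _ _ r00 q1 V0)[+ _]; exact: lt_le_trans.
have r01 : r0 < r0 + 1 by rewrite ltrDl.
(* V(r0) may be 0; one unit further V is strictly positive, because g > f > 0 makes V' > 0. *)
have V1 : 0 < V (r0 + 1).
  apply: (le_lt_trans V0); apply: (derive_gt0_lt r01).
    by move=> t /andP[t0 _]; apply: wronskian_derive; exact: lt_le_trans t0.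
  move=> t /andP[t0 _]; have tgt0 := lt_trans r00 t0; have ft := f_gt0 _ tgt0.
  have := above0 _ (ltW t0); rewrite /q ltr_pdivlMr// mul1r => fg.
  have gt := lt_trans ft fg.
  rewrite /dV !mulr_gt0// subr_gt0 ltr_sqr ?nnegrE ?ltW//.
have [M M0 gM] := g_oo; pose a := Num.max (r0 + 1) M.
have a0 : 0 < a by rewrite lt_max M0 orbT.
have ra : r0 + 1 <= a by rewrite le_max lexx.
have Ma : M <= a by rewrite le_max lexx orbT.
have c0 : 0 < V (r0 + 1) / 4 by rewrite divr_gt0.
(* f < g <= 2 gives f^2 <= 4, whence q' >= V(r0 + 1) / (4 r). The target 4 is out of reach where f
   >= 1/2 and g <= 2. *)
have [||L aL qL] := @log_growth _ q dq a (V (r0 + 1) / 4) 4 a0 c0.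
- by move=> r ar; apply: quotient_derive; exact: lt_le_trans ar.
- move=> r ar; have rgt0 := lt_le_trans a0 ar; have fr := f_gt0 _ rgt0.
  have r0r : r0 <= r by rewrite (le_trans _ ar)// (le_trans _ ra)// ltW.
  have := above0 _ r0r; rewrite /q ltr_pdivlMr// mul1r => fg.
  have /andP[_ g2] := gM r (le_trans Ma ar).
  have [_ Vr] := above _ _ (ltr_wpDl (ltW r00) ltr01) (above0 _ (ltW r01))
    (ltW V1) (le_trans ra ar).
  rewrite /dq ler_pdivlMr ?mulr_gt0 ?exprn_gt0//.
  have -> : V (r0 + 1) / 4 / r * (r * f r ^+ 2) = V (r0 + 1) * (f r ^+ 2 / 4).
    by field; rewrite gt_eqF.
  rewrite (le_trans _ Vr)// -[leRHS]mulr1 ler_pM2l// ler_pdivrMr// mul1r.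
  have := fr; nra.
have [r Lr /andP[f12 _]] := f_oo L.
have ar := le_trans aL Lr; have /andP[_ g2] := gM r (le_trans Ma ar).
have := qL r Lr; rewrite /q ltr_pdivlMr ?(f_gt0 _ (lt_le_trans a0 ar))//.
by move: f12 g2; lra.
Qed.

(** The mirror argument for q < 1. As g is only known to be nonnegative, the growth estimate starts
    beyond the radius of [g_oo], where g >= 1/2, and uses f / g in place of q. *)
Lemma quotient_ge1 (r0 : R) : 0 < r0 -> 1 <= q r0.
Proof.
move=> r00; rewrite leNgt; apply/negP => q1.
have [V0|V0] := lerP (V r0) 0; last first.
  apply: (@wronskian_not_bounded_away_at0 1 (V r0) r0) => //.
  - by rewrite normr1.
  move=> r /andP[rgt0 rr0]; rewrite mul1r.
  pose y t := 1 - q (- t); pose W t := V (- t).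
  have pos (t : R) : - r0 <= t <= - r -> 0 < - t.
    by move=> /andP[_ tr]; rewrite oppr_gt0 (le_lt_trans tr)// oppr_lt0.
  have [|||||||_] := @forward_invariance _ y W (fun t => dq (- t))
    (fun t => - dV (- t)) (- r0) (- r); last by rewrite /W !opprK.
  - by rewrite lerN2 ltW.
  - move=> t /pos t0; have := quotient_derive _ t0 => ?.
    by rewrite /y; apply: is_derive_eq; rewrite /=; ring.
  - move=> t /pos t0; have := wronskian_derive _ t0 => ?.
    by rewrite /W; apply: is_derive_eq; rewrite mulrN1.
  - move=> t /pos t0; rewrite /W.
    by have [] := quotient_slope_sign _ t0.
  - move=> t /pos t0; rewrite /y subr_gt0 oppr_ge0.
    by have [_] := wronskian_sign _ t0.
  - by rewrite /y opprK subr_gt0.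
  - by rewrite /W opprK ltW.
have below a r : 0 < a -> q a < 1 -> V a <= 0 -> a <= r ->
    q r <= q a /\ V r <= V a.
  move=> a0 qa Va ar; have pos (t : R) : a <= t <= r -> 0 < t.
    by move=> /andP[at' _]; exact: lt_le_trans at'.
  have [||||||] := @forward_invariance _ (fun t => 1 - q t) (fun t => - V t)
    (fun t => - dq t) (fun t => - dV t) a r ar.
  - move=> t /pos t0; have := quotient_derive _ t0 => ?.
    by apply: is_derive_eq; rewrite /=; ring.
  - by move=> t /pos t0; have := wronskian_derive _ t0 => ?; exact: is_deriveN.
  - move=> t /pos t0; rewrite /= !oppr_ge0.
    by have [_] := quotient_slope_sign _ t0.
  - move=> t /pos t0; rewrite /= subr_gt0 oppr_ge0.
    by have [_] := wronskian_sign _ t0.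
  - by rewrite /= subr_gt0.
  - by rewrite /= oppr_ge0.
  - by rewrite /= lerD2l !lerN2.
have [M M0 gM] := g_oo; pose a := Num.max r0 M.
have a0 : 0 < a by rewrite lt_max M0 orbT.
have ra : r0 <= a by rewrite le_max lexx.
have Ma : M <= a by rewrite le_max lexx orbT.
have below0 r : r0 <= r -> q r < 1 /\ V r <= 0.
  move=> /(below _ _ r00 q1 V0)[qr Vr].
  by rewrite (le_lt_trans qr)// (le_trans Vr).
have a1 : a < a + 1 by rewrite ltrDl.
have V1 : V (a + 1) < 0.
  rewrite -oppr_gt0 (@le_lt_trans _ _ (- V a))//.
    by rewrite oppr_ge0; have [] := below0 _ ra.
  apply: (@derive_gt0_lt _ (fun t => - V t) (fun t => - dV t) _ _ a1).
    move=> t /andP[t0 _]; have tgt0 := lt_le_trans a0 t0.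
    by have := wronskian_derive _ tgt0 => ?; exact: is_deriveN.
  move=> t /andP[t0 _]; have tgt0 := lt_trans a0 t0; have ft := f_gt0 _ tgt0.
  have [+ _] := below0 _ (le_trans ra (ltW t0)).
  rewrite /q ltr_pdivrMr// mul1r => fg.
  have /andP[g12 _] := gM t (le_trans Ma (ltW t0)).
  have gt : 0 < g t by rewrite (lt_le_trans _ g12)// invr_gt0.
  rewrite /dV -mulrN opprB !mulr_gt0// subr_gt0 ltr_sqr ?nnegrE ?ltW//.
pose p r := f r / g r; pose dp r := - V r / (r * g r ^+ 2).
have gpos r : a + 1 <= r -> 0 < r /\ 2^-1 <= g r <= 2.
  move=> ar; split; first by rewrite (lt_le_trans _ ar)// (lt_trans a0).
  by apply: gM; rewrite (le_trans Ma)// (le_trans _ ar)// ltW.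
have c0 : 0 < - V (a + 1) / 4 by rewrite divr_gt0// oppr_gt0.
have a10 : 0 < a + 1 := lt_trans a0 a1.
(* The divisor 4 bounds g^2, and the target 4 bounds f / g where f <= 2 and g >= 1/2. *)
have [||L aL pL] := @log_growth _ p dp (a + 1) (- V (a + 1) / 4) 4 a10 c0.
- move=> r /gpos[rgt0 /andP[g12 _]].
  have gr : g r != 0 by apply: lt0r_neq0; rewrite (lt_le_trans _ g12)// invr_gt0.
  have ? := is_deriveV gr (dg _ rgt0); have := df _ rgt0 => ?.
  rewrite /p; apply: is_derive_eq; rewrite /GRing.scale /= /dp /V.
  by field; rewrite gr lt0r_neq0.
- move=> r ar; have [rgt0 /andP[g12 g2]] := gpos _ ar.
  have gr : 0 < g r by rewrite (lt_le_trans _ g12)// invr_gt0.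
  have [qa Va] := below0 _ (le_trans ra (ltW a1)).
  have [_ Vr] := below _ _ a10 qa Va ar.
  rewrite /dp ler_pdivlMr ?mulr_gt0 ?exprn_gt0//.
  have -> : - V (a + 1) / 4 / r * (r * g r ^+ 2) = - V (a + 1) * (g r ^+ 2 / 4).
    by field; rewrite gt_eqF.
  rewrite (@le_trans _ _ (- V (a + 1)))// ?lerN2//.
  rewrite -[leRHS]mulr1 ler_pM2l ?oppr_gt0// ler_pdivrMr// mul1r.
  have := gr; nra.
have [r Lr /andP[_ f2]] := f_oo L.
have [rgt0 /andP[g12 g2]] := gpos _ (le_trans aL Lr).
have gr : 0 < g r by rewrite (lt_le_trans _ g12)// invr_gt0.
by have := pL r Lr; rewrite /p ltr_pdivlMr//; move: f2 g12; lra.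
Qed.

Lemma profile_unique (r : R) : 0 < r -> f r = g r.
Proof.
move=> r0; have : q r == 1 by rewrite eq_le quotient_le1// quotient_ge1.
have fr : f r != 0 by apply: lt0r_neq0; exact: f_gt0.
by rewrite /q -(inj_eq (mulIf fr)) divfK// mul1r => /eqP.
Qed.

End ProfileUniqueness.

(** * Reduction to the planar field *)

(** If v >= c on the half-plane [M <= p.1], which has infinite area, the simple function equal to
    [c] there and 0 elsewhere already has infinite integral. *)
Lemma infinite_strip_integral {R : realType} (v : R * R -> R) :
  (forall p, 0 <= v p) ->
  (\int[(@lebesgue_measure R) \x (@lebesgue_measure R)]_p (v p)%:E < +oo)%E ->
  forall M c, 0 < c -> exists2 p, M <= p.1 & v p < c.
Proof.
move=> v0 vfin M c c0; apply: contrapT => nex.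
have vc p : M <= p.1 -> c <= v p.
  by move=> Mp; rewrite leNgt; apply/negP => vp; apply: nex; exists p.
move: vfin; apply/negP; rewrite -leNgt ge0_integralTE; last first.
  by move=> p; rewrite lee_fin.
have mA : measurable (`[M, +oo[%classic `*` [set: R]
    : set (measurableTypeR R * measurableTypeR R)).
  by apply: measurableX => //; exact: measurable_itv.
apply: ereal_sup_ubound.
exists (scale_nnsfun (indic_nnsfun R mA) (ltW c0)) => /=.
  move=> p; rewrite lee_fin -[leLHS]/(c * \1_(`[M, +oo[%classic `*` [set: R]) p) indicE.
  case: (boolP (p \in _)) => [|_] /=; last by rewrite mulr0.
  by rewrite inE => -[/= + _]; rewrite in_itv/= andbT mulr1; exact: vc.
rewrite sintegralrM sintegral_indic.
rewrite /= product_measure1E; [|exact: measurable_itv|exact: measurableT].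
have A : lebesgue_measure (`[M, +oo[%classic : set R) = +oo%E.
  by rewrite lebesgue_measure_itv/= ltry.
have B : lebesgue_measure [set: R] = +oo%E.
  by rewrite -set_itvNyy lebesgue_measure_itv/=.
by rewrite [X in (_ * (X * _))%E]A [X in (_ * (_ * X))%E]B mulyy gt0_muley ?lte_fin.
Qed.

(** The components of [rotate beta] are the forms with coefficients (cos beta, - sin beta) and (sin
    beta, cos beta). *)
Definition lin {R : realType} (k1 k2 : R) (z : R * R) : R :=
  k1 * z.1 + k2 * z.2.

Lemma lin_continuous {R : realType} (k1 k2 : R) : continuous (lin k1 k2).
Proof.
move=> z; apply: cvgD; apply: cvgM; [exact: cvg_cst|exact: cvg_fst|
  exact: cvg_cst|exact: cvg_snd].
Qed.

Lemma lin_derive_cvg {R : realType} (k1 k2 : R) (f : R * R -> R * R)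
    (x v : R * R) : derivable f x v ->
  h^-1 *: (lin k1 k2 (f (h *: v + x)) - lin k1 k2 (f x)) @[h --> 0^']
    --> lin k1 k2 ('D_v f x).
Proof.
move=> df.
have := cvg_comp _ _ df (@lin_continuous R k1 k2 ('D_v f x)).
apply: cvg_trans; apply: near_eq_cvg; near=> h.
by rewrite /lin /= /GRing.scale /=; ring.
Unshelve. all: by end_near. Qed.

Lemma lin_derive {R : realType} (k1 k2 : R) (f : R * R -> R * R) (x v : R * R) :
  derivable f x v -> 'D_v (fun y => lin k1 k2 (f y)) x = lin k1 k2 ('D_v f x).
Proof. by move=> /(lin_derive_cvg k1 k2) h; apply: cvg_lim h. Qed.

Lemma C1_lin {R : realType} (f : R * R -> R * R) (k1 k2 : R) (x0 : R * R) :
  C1 f -> is_C1 (fun p : R * R => lin k1 k2 (f (p + x0)))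
    (fun p => lin k1 k2 ('D_(e1 R) f (p + x0)))
    (fun p => lin k1 k2 ('D_(e2 R) f (p + x0))).
Proof.
move=> [d1 d2 c1 c2].
have cs (k : R * R -> R * R) : continuous k ->
    continuous (fun p : R * R => lin k1 k2 (k (p + x0))).
  move=> ck p.
  have cp : (fun p : R * R => p + x0) @ p --> p + x0.
    by apply: cvgD; [exact: cvg_id|exact: cvg_cst].
  exact: (cvg_comp _ _ (cvg_comp _ _ cp (ck _)) (lin_continuous _ _ _)).
have is_derive_cvg (g : R -> R) (x l : R) :
    h^-1 *: (g (h *: 1 + x) - g x) @[h --> 0^'] --> l -> is_derive x 1 g l.
  by move=> gl; apply: DeriveDef; [apply/cvg_ex; exists l|apply: cvg_lim gl].
split; [exact: (cs _ c1)|exact: (cs _ c2)| |] => x y; apply: is_derive_cvg.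
- have := lin_derive_cvg k1 k2 _ _ _ (d1 ((x, y) + x0)).
  apply: cvg_trans; apply: near_eq_cvg; near=> h.
  congr (_ *: (lin k1 k2 (f _) - _)); rewrite addrA; congr (_ + _).
  by rewrite /e1; congr (_, _); rewrite /= /GRing.scale /= ?mulr0 ?add0r.
- have := lin_derive_cvg k1 k2 _ _ _ (d2 ((x, y) + x0)).
  apply: cvg_trans; apply: near_eq_cvg; near=> h.
  congr (_ *: (lin k1 k2 (f _) - _)); rewrite addrA; congr (_ + _).
  by rewrite /e2; congr (_, _); rewrite /= /GRing.scale /= ?mulr0 ?add0r.
Unshelve. all: by end_near. Qed.

Lemma is_C1_unique {R : realType} {f f1 f2 g1 g2 : R * R -> R} :
  is_C1 f f1 f2 -> is_C1 f g1 g2 -> f1 = g1 /\ f2 = g2.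
Proof.
move=> [_ _ df1 df2] [_ _ dg1 dg2]; split; apply/funext => -[x y].
  by have [_ <-] := df1 x y; have [_ <-] := dg1 x y.
by have [_ <-] := df2 x y; have [_ <-] := dg2 x y.
Qed.

Lemma enorm_rotate {R : realType} (beta : R) (z : R * R) :
  enorm z ^+ 2 = lin (cos beta) (- sin beta) z ^+ 2
    + lin (sin beta) (cos beta) z ^+ 2.
Proof.
rewrite sqr_sqrtr ?addr_ge0 ?sqr_ge0// /lin.
rewrite -[LHS]mul1r -(cos2Dsin2 beta); ring.
Qed.

Lemma lin_opp_eq {R : realType} (k1 k2 : R) {c : R} {a b z : R * R} :
  - (a + b) = c *: z -> - c * lin k1 k2 z = lin k1 k2 a + lin k1 k2 b.
Proof.
case: a b z => [a1 a2] [b1 b2] [z1 z2] [E1 E2].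
transitivity (k1 * (a1 + b1) + k2 * (a2 + b2)); last by rewrite /lin /=; ring.
by rewrite -[a1 + _]opprK -[a2 + _]opprK E1 E2 /lin /GRing.scale /=; ring.
Qed.

(** Curl-freeness identifies d1 w2 with d2 w1, which becomes [h12]. For such a field grad (div w) is
    the Laplacian of w, by symmetry of second derivatives, and the equation evaluates this
    Laplacian, rotations preserving |u|. *)
Lemma rotated_field_is_C1 {R : realType} (u : R * R -> R * R) (beta : R)
    (x0 : R * R) :
  let w1 := fun p : R * R => lin (cos beta) (- sin beta) (u (p + x0)) in
  let w2 := fun p : R * R => lin (sin beta) (cos beta) (u (p + x0)) in
  C2 u ->
  (forall x, - laplacian u x = (1 - enorm (u x) ^+ 2) *: u x) ->
  (forall x, curl (fun y => rotate beta (u y)) x = 0) ->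
  exists h11 h12 h22 : R * R -> R, [/\ is_C1 w1 h11 h12, is_C1 w2 h12 h22 &
    is_C1 (fun p => h11 p + h22 p)
      (fun p => (w1 p * w1 p + w2 p * w2 p + -1) * w1 p)
      (fun p => (w1 p * w1 p + w2 p * w2 p + -1) * w2 p)].
Proof.
move=> w1 w2 [C1u C1u1 C1u2] GL curl0.
pose L1 (f : R * R -> R * R) p := lin (cos beta) (- sin beta) (f (p + x0)).
pose L2 (f : R * R -> R * R) p := lin (sin beta) (cos beta) (f (p + x0)).
have C1L1 (f : R * R -> R * R) : C1 f ->
    is_C1 (L1 f) (L1 ('D_(e1 R) f)) (L1 ('D_(e2 R) f)) by exact: C1_lin.
have C1L2 (f : R * R -> R * R) : C1 f ->
    is_C1 (L2 f) (L2 ('D_(e1 R) f)) (L2 ('D_(e2 R) f)) by exact: C1_lin.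
have A1 := C1L1 _ C1u; have A2 := C1L2 _ C1u.
have B11 := C1L1 _ C1u1; have B12 := C1L1 _ C1u2.
have B21 := C1L2 _ C1u1; have B22 := C1L2 _ C1u2.
have sym1 := Schwarz A1 B11 B12; have sym2 := Schwarz A2 B21 B22.
have curlE : L2 ('D_(e1 R) u) = L1 ('D_(e2 R) u).
  apply/funext => p; have [du1 du2 _ _] := C1u.
  have rot1 : (fun y => (rotate beta (u y)).1) =
      (fun y => lin (cos beta) (- sin beta) (u y)).
    by apply/funext => y; rewrite /lin /rotate /= mulNr.
  have := curl0 (p + x0).
  by rewrite /curl rot1 (lin_derive _ _ _ _ _ (du1 _)) (lin_derive _ _ _ _ _ (du2 _))
    => /eqP; rewrite subr_eq0 => /eqP.
have {}A2 : is_C1 w2 (L1 ('D_(e2 R) u)) (L2 ('D_(e2 R) u)) :=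
  eq_ind _ (fun k => is_C1 w2 k _) A2 _ curlE.
have {}B21 : is_C1 (L1 ('D_(e2 R) u)) (L2 ('D_(e1 R) ('D_(e1 R) u)))
  (L2 ('D_(e2 R) ('D_(e1 R) u))) := eq_ind _ (fun k => is_C1 k _ _) B21 _ curlE.
(* The function h12 is C1 both as d2 w1 and as d1 w2; uniqueness of its partial derivatives equates
   second derivatives of w1 and w2. *)
have [x1 x2] := is_C1_unique B12 B21.
have rhoE p : - (1 - enorm (u (p + x0)) ^+ 2) = w1 p * w1 p + w2 p * w2 p + -1.
  by rewrite (enorm_rotate beta) opprB -!expr2.
have lap k1 k2 p : (w1 p * w1 p + w2 p * w2 p + -1) * lin k1 k2 (u (p + x0)) =
    lin k1 k2 ('D_(e1 R) ('D_(e1 R) u) (p + x0))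
    + lin k1 k2 ('D_(e2 R) ('D_(e2 R) u) (p + x0)).
  exact: etrans (congr1 (fun t => t * _) (esym (rhoE p)))
    (lin_opp_eq k1 k2 (GL (p + x0))).
exists (L1 ('D_(e1 R) u)), (L1 ('D_(e2 R) u)), (L2 ('D_(e2 R) u)).
split; [exact: A1|exact: A2|].
have E1 p : (w1 p * w1 p + w2 p * w2 p + -1) * w1 p =
    L1 ('D_(e1 R) ('D_(e1 R) u)) p + L2 ('D_(e1 R) ('D_(e2 R) u)) p.
  have e : L1 ('D_(e2 R) ('D_(e2 R) u)) p = L2 ('D_(e1 R) ('D_(e2 R) u)) p :=
    etrans (congr1 (fun k => k p) x2) (congr1 (fun k => k p) sym2).
  exact: etrans (lap (cos beta) (- sin beta) p) (congr1 (fun t => _ + t) e).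
have E2 p : (w1 p * w1 p + w2 p * w2 p + -1) * w2 p =
    L1 ('D_(e2 R) ('D_(e1 R) u)) p + L2 ('D_(e2 R) ('D_(e2 R) u)) p.
  have e : L1 ('D_(e2 R) ('D_(e1 R) u)) p = L2 ('D_(e1 R) ('D_(e1 R) u)) p :=
    etrans (congr1 (fun k => k p) sym1) (congr1 (fun k => k p) x1).
  exact: etrans (lap (sin beta) (cos beta) p) (congr1 (fun t => t + _) (esym e)).
exact: (eq_ind_r (fun k => is_C1 _ k _)
  (eq_ind_r (fun k => is_C1 _ _ k) (is_C1D B11 B22) (funext E2)) (funext E1)).
Qed.

(** f < 1/2 would make the square exceed 9/16, and f > 2 would make it exceed 9. *)
Lemma near_one {R : realType} (f : R) :
  0 < f -> (1 - f ^+ 2) ^+ 2 < 2^-1 -> 2^-1 <= f <= 2.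
Proof.
move=> f0 v; rewrite !leNgt -negb_or; apply/negP => /orP[] h.
  have f2 : f ^+ 2 < 4^-1 by nra.
  nra.
have f2 : 4 < f ^+ 2 by nra.
nra.
Qed.

Lemma nonneg_vortex_profileP {R : realType} (g : R -> R) :
  nonneg_vortex_profile g -> exists gp : R -> R,
  [/\ forall r, 0 < r -> 0 <= g r,
      forall r : R, 0 < r -> is_derive r 1 g (gp r),
      forall r : R, 0 < r -> is_derive r 1 gp
        (g r / r ^+ 2 - gp r / r + g r * (g r ^+ 2 - 1)),
      forall e, 0 < e -> exists2 d, 0 < d & forall r, 0 < r < d -> g r < e &
      exists2 M, 0 < M & forall r, M <= r -> 2^-1 <= g r <= 2].
Proof.
move=> [g0 [ode [_ [cg0 cgoo]]]]; exists (derive1 g); split.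
- by move=> r /ltW; exact: g0.
- by move=> r /ode[dg _ _]; rewrite derive1E; exact: derivableP.
- move=> r r0; have [_ ddg E] := ode r r0.
  suff -> : g r / r ^+ 2 - derive1 g r / r + g r * (g r ^+ 2 - 1) =
    'D_1 (derive1 g) r by exact: derivableP.
  rewrite -derive1E; move: E; rewrite ![_^-1 * _]mulrC; lra.
- move=> e e0; have /cvgrPdist_lt/(_ e e0)/nbhs_ballP[d /= d0 Hd] := cg0.
  exists d => // r /andP[r0 rd].
  have /Hd/(_ r0) : ball 0 d r by rewrite /ball/= sub0r normrN gtr0_norm.
  by rewrite /= sub0r normrN => /(le_lt_trans (ler_norm _)).
- have h0 : 0 < 2^-1 :> R by rewrite invr_gt0.
  have /cvgrPdist_lt/(_ _ h0)[M [_ HM]] := cgoo.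
  (* The threshold at infinity may be negative and is strict; this choice repairs both. *)
  exists (Num.max M 0 + 1) => [|r Mr].
    by rewrite ltr_pwDr// le_max lexx orbT.
  have /HM : M < r.
    by rewrite (lt_le_trans _ Mr)// (@le_lt_trans _ _ (Num.max M 0)) ?ltrDl// le_max lexx.
  rewrite /= ltr_norml => /andP[A B]; apply/andP; split; lra.
Qed.

(** * Identification of the radial profile of the field with [f1] *)

Theorem theorem1 (R : realType) (u : R * R -> R * R) (beta : R) (x0 : R * R)
    (f1 : R -> R)
    (u_C2 : C2 u)
    (u_GL : forall x : R * R,
       - laplacian u x = (1 - enorm (u x) ^+ 2) *: u x)
    (u_potential :
       (\int[(@lebesgue_measure R) \x (@lebesgue_measure R)]_x
          ((1 - enorm (u x) ^+ 2) ^+ 2)%:E < +oo)%E)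
    (beta_range : 0 <= beta < 2 * pi)
    (u_curl : forall x : R * R, curl (fun y => rotate beta (u y)) x = 0)
    (u_zero : forall x : R * R, u x = 0 <-> x = x0)
    (f1_profile : nonneg_vortex_profile f1) :
  exists eps : R, (eps = 1 \/ eps = -1) /\
    forall x : R * R,
      rotate beta (u (x + x0))
        = eps *: (f1 (enorm x) *: ((enorm x)^-1 *: x)).
Proof.
have [h11 [h12 [h22 [C1w1 C1w2 C1div]]]] :=
  rotated_field_is_C1 u beta x0 u_C2 u_GL u_curl.
pose w1 p := lin (cos beta) (- sin beta) (u (p + x0)).
pose w2 p := lin (sin beta) (cos beta) (u (p + x0)).
rewrite -/w1 -/w2 in C1w1 C1w2 C1div.
have ux0 : u x0 = 0 by apply/u_zero.
have w10 : w1 (0, 0) = 0.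
  by rewrite /w1 (_ : (0, 0) + x0 = x0) ?ux0 ?/lin/= ?mulr0 ?addr0// [LHS]add0r.
have w20 : w2 (0, 0) = 0.
  by rewrite /w2 (_ : (0, 0) + x0 = x0) ?ux0 ?/lin/= ?mulr0 ?addr0// [LHS]add0r.
have w_eq0 p : w1 p = 0 -> w2 p = 0 -> p = (0, 0).
  move=> p1 p2; have : enorm (u (p + x0)) ^+ 2 = 0.
    by rewrite (enorm_rotate beta) -/(w1 p) -/(w2 p) p1 p2 expr0n addr0.
  rewrite sqr_sqrtr ?addr_ge0 ?sqr_ge0// => /eqP.
  rewrite paddr_eq0 ?sqr_ge0// !sqrf_eq0 => /andP[/eqP a0 /eqP b0].
  have /u_zero : u (p + x0) = 0 by rewrite [LHS]surjective_pairing a0 b0.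
  by move=> /(canRL (addrK _)); rewrite subrr.
have radial := radial_form _ _ _ _ _ C1w1 C1w2 C1div w_eq0 w10 w20.
have [eps [epsE Fpos]] := profile_sign _ _ _ _ _ C1w1 C1w2 C1div w_eq0 w10 w20.
have [K K0 bound] := profile_bound _ _ _ _ _ C1w1 C1w2 C1div w_eq0 w10 w20.
have dF := profile_derive _ _ _ _ _ C1w1 C1w2 C1div w_eq0 w10 w20.
have dFp := profile_derive2 _ _ _ _ _ C1w1 C1w2 C1div w_eq0 w10 w20.
have eps2 : eps * eps = 1 by case: epsE => ->; rewrite ?mulrNN mulr1.
have epsN : `|eps| = 1 by case: epsE => ->; rewrite ?normrN normr1.
have [gp [g0 dg dgp gz goo]] := nonneg_vortex_profileP _ f1_profile.
have r_ge p : `|p.1| <= @enorm R p.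
  by rewrite -sqrtr_sqr ler_wsqrtr// lerDl sqr_ge0.
have f1E r : 0 < r -> eps * w1 (r, 0) = f1 r.
  apply: (profile_unique (fun r => eps * w1 (r, 0))
    (fun r => eps * (h11 (r, 0) + h22 (r, 0) - w1 (r, 0) / r)) f1 gp K).
  - exact: Fpos.
  - exact: g0.
  - by move=> s s0; have := dF s s0 => ?; apply: is_derive_eq.
  - move=> s s0; have := dFp s s0 => ?; apply: is_derive_eq.
    rewrite /GRing.scale /=; move: (w1 (s, 0)) => F.
    have -> : eps * F * ((eps * F) ^+ 2 - 1) =
       eps * F * (eps * eps * F ^+ 2 - 1) by ring.
    by rewrite eps2; ring.
  - exact: K0.
  - move=> s s01; have [+ _] := bound s s01; apply: le_trans.
    by rewrite -[leRHS]mul1r -epsN -normrM ler_norm.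
  - by move=> s s01; have [_ +] := bound s s01; rewrite normrM epsN mul1r.
  - exact: gz.
  - exact: goo.
  - move=> M.
    have v0 p : 0 <= (1 - enorm (u p) ^+ 2) ^+ 2 by exact: sqr_ge0.
    have c0 : 0 < 2^-1 :> R by rewrite invr_gt0.
    (* The shift by [x0.1] makes |p - x0| at least [M], and the maximum with 1 keeps this radius
       positive; the radial form identifies |u(p)| with the profile there. *)
    have [p Mp vp] := infinite_strip_integral _ v0 u_potential
      (Num.max M 1 + x0.1) _ c0.
    pose x := p - x0; have px : p = x + x0 by rewrite subrK.
    have rM : Num.max M 1 <= enorm x.
      rewrite (le_trans _ (r_ge _))// (le_trans _ (ler_norm _))//.
      by rewrite lerBrDr.
    have r0 : 0 < enorm x by rewrite (lt_le_trans _ rM)// lt_max ltr01 orbT.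
    exists (enorm x); first by rewrite (le_trans _ rM)// le_max lexx.
    have fpos := Fpos _ r0.
    suff E : enorm (u p) ^+ 2 = (eps * w1 (enorm x, 0)) ^+ 2.
      by apply: near_one => //; rewrite -E.
    have [e1' e2'] := radial x.
    have rn0 : enorm x ^+ 2 != 0 by rewrite sqrf_eq0 lt0r_neq0.
    apply: (mulfI rn0).
    have r2 : enorm x ^+ 2 = x.1 ^+ 2 + x.2 ^+ 2.
      by rewrite sqr_sqrtr// addr_ge0 ?sqr_ge0.
    have nE : enorm (u p) ^+ 2 = w1 x ^+ 2 + w2 x ^+ 2.
      by rewrite px; exact: enorm_rotate.
    transitivity ((enorm x * w1 x) ^+ 2 + (enorm x * w2 x) ^+ 2).
      by rewrite nE; ring.
    rewrite e1' e2'.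
    transitivity (eps * eps * w1 (enorm x, 0) ^+ 2 * (x.1 ^+ 2 + x.2 ^+ 2)).
      by rewrite eps2; ring.
    by rewrite -r2; ring.
exists eps; split=> // x.
have -> : rotate beta (u (x + x0)) = (w1 x, w2 x).
  by rewrite /rotate /w1 /w2 /lin mulNr.
have [e1' e2'] := radial x.
have [r0|r0] := eqVneq (enorm x) 0.
  (* Here x = 0 and the right side is a multiple of x, whatever the inverse of 0 is. *)
  have [x10 x20] : x.1 = 0 /\ x.2 = 0.
    move/eqP: r0; rewrite sqrtr_eq0 => h; have := sqr_ge0 x.1; have := sqr_ge0 x.2.
    by move=> a b; split; apply/eqP; rewrite -sqrf_eq0 eq_le ?sqr_ge0 ?andbT; lra.
  have -> : x = (0, 0) by rewrite [LHS]surjective_pairing x10 x20.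
  by rewrite w10 w20 !scaler0.
have rgt0 : 0 < enorm x by rewrite lt0r r0 sqrtr_ge0.
have FE : w1 (enorm x, 0) = eps * f1 (enorm x).
  by rewrite -f1E// mulrA eps2 mul1r.
rewrite FE in e1' e2'.
have a1 : w1 x = eps * (f1 (enorm x) * ((enorm x)^-1 * x.1)).
  by apply: (mulfI r0); rewrite e1'; field.
have a2 : w2 x = eps * (f1 (enorm x) * ((enorm x)^-1 * x.2)).
  by apply: (mulfI r0); rewrite e2'; field.
by rewrite a1 a2.
Qed.
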